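(* (Complexity of MLMC with levels based on the number of particles.) Let $\phi_\infty\in\mathbb{R}$, let $\gamma_{\mathrm p}\ge1$ and $0\le s_{\mathrm p}\le1$. Let $\beta_{\mathrm p}\ge2$ be an integer and $P_\ell=\beta_{\mathrm p}^{\ell}$. Suppose that, with constants independent of $N$, $P$ and $\ell$, the particle approximations $\phi_P^N$ and coarse couplings $\varphi_{P_{\ell-1}}^N$ (described in the context) satisfy $$|\mathrm{E}[\phi_P^N]-\phi_\infty|\lesssim N^{-1}+P^{-1},\qquad \mathrm{Var}[\phi_P^N]\lesssim P^{-1},\qquad \mathrm{Var}\big[\phi_{P_\ell}^{N}-\varphi_{P_{\ell-1}}^{N}\big]\lesssim P_\ell^{-s_{\mathrm p}-1},$$ and that the work of generating one sample of $\phi_{P_\ell}^{N}-\varphi_{P_{\ell-1}}^{N}$ is $\lesssim N P_\ell^{\gamma_{\mathrm p}}$. For fixed $0<\epsilon<1$ and any $0<\mathrm{TOL}<e^{-1}$, there exist $L$, a number of time steps $N_L$ (the same on all levels), and numbers of samples $\{M_\ell\}_{\ell=0}^L$ such that the estimator $$\mathcal{A}_{\mathrm{MLMC}}=\sum_{\ell=0}^L\frac1{M_\ell}\sum_{m=1}^{M_\ell}\big(\phi_{P_\ell}^{N_L}-\varphi_{P_{\ell-1}}^{N_L}\big)\big(\boldsymbol\omega_{1:P_\ell}^{(\ell,m)}\big)$$ satisfies $\mathrm{P}[|\mathcal{A}_{\mathrm{MLMC}}-\phi_\infty|\ge\mathrm{TOL}]\le\epsilon$ and $$\mathrm{Work}[\mathcal{A}_{\mathrm{MLMC}}]\lesssim\begin{cases}\mathrm{TOL}^{-3}&\text{if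 } s_{\mathrm p}+1>\gamma_{\mathrm p},\\ \mathrm{TOL}^{-3}(\log(\mathrm{TOL}^{-1}))^2&\text{if } s_{\mathrm p}+1=\gamma_{\mathrm p},\\ \mathrm{TOL}^{-2-\gamma_{\mathrm p}+s_{\mathrm p}}&\text{if } s_{\mathrm p}+1<\gamma_{\mathrm p}.\end{cases}$$
   Context: $a\lesssim b$ means $a<cb$ for a constant $c$; in the conclusion $c$ is independent of $\mathrm{TOL}$ (it may depend on $\epsilon$). For positive integers $P,N$, $\phi_P^N=\frac1P\sum_{p=1}^P\psi(X_{p|P}^{N|N})$ is the average of a quantity of interest $\psi$ over $P$ exchangeable particles at final time $T$, where the particles follow a system of coupled SDEs in which particle $p$ is driven by its Wiener process $W_p$ and interacts with the others through the empirical measure of the system, approximated by a time-stepping scheme with $N$ uniform steps. $\phi_\infty=\mathrm{E}[\psi(X_\infty(T))]$ is the corresponding mean-field value ($X_\infty$ solves the limiting McKean-Vlasov SDE). $\boldsymbol\omega_{1:P}$ denotes the collection of underlying random inputs of the $P$ particles (Wiener paths, initial values, random coefficients), i.i.d. over particles, $\boldsymbol\omega_{p:q}$ the inputs of particles $p,\dots,q$, and $\boldsymbol\omega_{1:P_\ell}^{(\ell,m)}$ are samples, mutually independent over $(\ell,m)$; $\phi_P^N$ is a function of the inputs of $P$ particles. The coarse coupling $\varphi_{P_{\ell-1}}^{N}$ is a function of $\boldsymbol\omega_{1:P_\ell}$ with $\varphi_{P_{-1}}^N=0$ and $\mathrm{E}[\varphi_{P_{\ell-1}}^N]=\mathrm{E}[\phi_{P_{\ell-1}}^N]$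 for $\ell\ge1$; the two choices considered are $\varphi_{P_{\ell-1}}^N(\boldsymbol\omega_{1:P_\ell})=\phi_{P_{\ell-1}}^N(\boldsymbol\omega_{1:P_{\ell-1}})$ and the partitioning sampler $\varphi_{P_{\ell-1}}^N(\boldsymbol\omega_{1:P_\ell})=\frac1{\beta_{\mathrm p}}\sum_{i=1}^{\beta_{\mathrm p}}\phi_{P_{\ell-1}}^N(\boldsymbol\omega_{(i-1)P_{\ell-1}+1\,:\,iP_{\ell-1}})$. $\mathrm{Work}[\mathcal{A}_{\mathrm{MLMC}}]$ is the sum over $\ell$ of $M_\ell$ times the work of one sample of the level-$\ell$ difference. The numbers of samples are positive integers. *)

(* Defs.v *)
From HB Require Import structures.
From mathcomp Require Import all_boot all_order all_algebra all_fingroup.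
From mathcomp Require Import all_classical all_reals all_analysis.

Set Implicit Arguments.
Unset Strict Implicit.
Unset Printing Implicit Defensive.

Import Order.TTheory GRing.Theory Num.Theory.
Import numFieldNormedType.Exports.

Local Open Scope classical_set_scope.
Local Open Scope ring_scope.

(* The bound 'a <~ b', i.e. a < c * b with one constant c for all the indices *)
(* i that satisfy D. The left-hand side is extended-real because means and    *)
(* variances are; the bound makes it finite.                                  *)
Definition lesssim (R : realType) (I : Type) (D : I -> Prop)
    (a : I -> \bar R) (b : I -> R) : Prop :=
  exists c : R, forall i, D i -> (a i < (c * b i)%:E)%E.

Section Randomness.
Context (dO : measure_display) (Omega : measurableType dO) (R : realType).
Context (Pr : probability Omega R).

Definition mutually_independent (I : eqType) (d : measure_display)
    (T : I -> measurableType d) (X : forall i, Omega -> T i) : Prop :=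
  forall J : seq I, uniq J ->
  forall A : forall i, set (T i), (forall i, measurable (A i)) ->
  Pr (\big[setI/setT]_(i <- J) (X i @^-1` A i)) =
  (\prod_(i <- J) Pr (X i @^-1` A i))%E.

Definition identically_distributed (d : measure_display)
    (T : measurableType d) (X Y : Omega -> T) : Prop :=
  forall A : set T, measurable A -> Pr (X @^-1` A) = Pr (Y @^-1` A).

Definition iid (d : measure_display) (T : measurableType d)
    (X : nat -> Omega -> T) : Prop :=
  mutually_independent X /\
  forall p q, identically_distributed (X p) (X q).

Definition exchangeable (d : measure_display) (T : measurableType d) (n : nat)
    (X : Omega -> n.-tuple T) : Prop :=
  forall s : 'S_n, identically_distributed
    (fun x => [tuple tnth (X x) (s p) | p < n]) X.

(* omega_{1:P}; particles are numbered from 0. *)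
Definition inputs (d : measure_display) (T : measurableType d)
    (omega : nat -> Omega -> T) (P : nat) : Omega -> P.-tuple T :=
  fun x => [tuple omega p x | p < P].

End Randomness.

(* phi_P^N as a function of the inputs of P particles. X N P maps these       *)
(* inputs to the P particle states at the final time, computed with N steps.  *)
Definition particle_average (R : realType) (In S : Type) (psi : S -> R)
    (X : forall N P : nat, P.-tuple In -> P.-tuple S)
    (N P : nat) (u : P.-tuple In) : R :=
  P%:R^-1 * \sum_(p < P) psi (tnth (X N P u) p).

Arguments particle_average {R In S} psi X N P u.

(* phi N P is averaged over P particles; coarse N l stands for the coupling   *)
(* varphi_{P_{l-1}}^N, which takes the P_l = beta ^ l inputs of level l.      *)
Section Multilevel.
Context (R : realType) (d : measure_display) (In : measurableType d).
Context (beta : nat).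
Variable phi : forall N P : nat, P.-tuple In -> R.
Variable coarse : forall N l : nat, (beta ^ l).-tuple In -> R.

Definition level_diff (N l : nat) (u : (beta ^ l).-tuple In) : R :=
  @phi N (beta ^ l)%N u - @coarse N l u.

Record coarse_coupling (dO : measure_display) (Omega : measurableType dO)
    (Pr : probability Omega R) (omega : nat -> Omega -> In) : Prop := {
  coarse_measurable : forall N l, (0 < N)%N ->
    measurable_fun [set: (beta ^ l).-tuple In] (@coarse N l);
  coarse_level0 : forall N (u : (beta ^ 0).-tuple In), (0 < N)%N ->
    coarse N u = 0;
  coarse_mean : forall N l, (0 < N)%N ->
    ('E_Pr[@coarse N l.+1 \o inputs omega (beta ^ l.+1)] =
     'E_Pr[@phi N (beta ^ l)%N \o inputs omega (beta ^ l)])%E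
}.

(* samples l m is the m-th sample (from 0) of omega_{1:P_l} on level l. *)
Definition mlmc_estimator (Omega : Type)
    (samples : forall l m : nat, Omega -> (beta ^ l).-tuple In)
    (L N : nat) (M : nat -> nat) (x : Omega) : R :=
  \sum_(0 <= l < L.+1)
    (M l)%:R^-1 * \sum_(0 <= m < M l) @level_diff N l (samples l m x).

End Multilevel.

Arguments level_diff {R d In beta} phi coarse N l u.

(* work N l is the work of one sample of the level-l difference. *)
Definition mlmc_work (R : realType) (work : nat -> nat -> R)
    (L N : nat) (M : nat -> nat) : R :=
  \sum_(0 <= l < L.+1) (M l)%:R * work N l.

Definition mlmc_rate (R : realType) (gamma s TOL : R) : R :=
  if gamma < s + 1 then TOL ^- 3
  else if s + 1 == gamma then TOL ^- 3 * ln (TOL^-1) ^+ 2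
  else TOL `^ (- 2 - gamma + s).

(* Main.v *)
Require Import Defs.
From HB Require Import structures.
From mathcomp Require Import all_boot all_order all_algebra all_fingroup.
From mathcomp Require Import all_classical all_reals all_analysis.
From mathcomp Require Import measurable_realfun ring lra.

Set Implicit Arguments.
Unset Strict Implicit.
Unset Printing Implicit Defensive.

Import Order.TTheory GRing.Theory Num.Theory.
Import numFieldNormedType.Exports.

Local Open Scope classical_set_scope.
Local Open Scope ring_scope.

(** The means of the level differences telescope, so the estimator has the mean
    of phi_P^N on its finest level. Taking as many time steps as particles on
    that level, N = P_L = beta ^ L of order TOL^-1, makes the bias at most
    TOL / 2 ([finest_level_exists]). Distinct samples are independent, hence
    uncorrelated, so the variance of the estimator is the sum of V_l / M_l
    ([variance_mlmc_estimator]), and Chebyshev's inequality gives the error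
    probability once this sum is at most eps * TOL ^ 2 / 4
    ([chebyshev_with_bias]).

    Write w ^ l, g ^ l for the orders P_l ^ (- s - 1) and P_l ^ gamma of the
    variance and of the cost of a level (per time step), and r for the geometric
    mean of w and g. Minimizing the cost at a given variance makes M_l
    proportional to (w / g) ^ (l / 2) = (r / g) ^ l; with M_l of order
    TOL^-2 S (r / g) ^ l, where S is the sum of the r ^ l, the variance is of
    order TOL ^ 2, and the work is of order N TOL^-2 S ^ 2, plus
    N (g ^ 0 + ... + g ^ L), of order TOL ^ (- 1 - gamma), for rounding up to
    integers ([sample_numbers_exist]). The rounding term is within the rate
    because s <= 1 ([cost_one_sample_le_rate]). The three regimes of the rate
    are those of the geometric sum S with ratio
    r = beta ^ ((gamma - s - 1) / 2): bounded, L + 1, or of order r ^ L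
    ([level_sum_le_rate]). *)

(** * Independence, covariance and tails *)

(** The variance is the squared L^2 distance to a constant function, and
    constants are square integrable. *)
Lemma Lfun2_of_variance (R : realType) (d : measure_display)
    (T : measurableType d) (P : probability T R) (X : T -> R) :
  measurable_fun [set: T] X -> ('V_P[X] < +oo)%E -> X \in Lfun P 2%:E.
Proof.
move=> mX; rewrite /variance unlock => VX.
set c := fine _ in VX.
have X'2 : (X \- cst c) \in Lfun P 2%:E.
  have mX' : measurable_fun [set: T] (X \- cst c) by exact: measurable_funB.
  rewrite inE; apply/andP; split; first by rewrite inE.
  rewrite inE /= /finite_norm unlock /= poweR_lty//.
  apply: le_lt_trans VX; rewrite unlock.
  apply: ge0_le_integral => //=.
  - apply/measurable_EFinP.
    apply/(@measurableT_comp _ _ _ _ _ _ (fun x : R => x `^ 2)%R) => //.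
    exact/measurableT_comp.
  - by apply/measurable_EFinP; apply: measurable_funM.
  - by move=> x _; rewrite lee_fin powR_mulrn// real_normK ?num_real// expr2.
have -> : X = (X \- cst c) \+ cst c by apply/funext => x /=; rewrite subrK.
by rewrite rpredD ?lee1n//= Lfun_cst.
Qed.

(** The positive and the negative part each transfer through the common law,
    so the equality of means needs no case analysis on integrability. *)
Lemma expectation_comp_identically_distributed (R : realType)
    (d d' : measure_display) (T : measurableType d) (T' : measurableType d')
    (P : probability T R) (X Y : T -> T') (f : T' -> R) :
  measurable_fun [set: T] X -> measurable_fun [set: T] Y ->
  measurable_fun [set: T'] f -> identically_distributed P X Y ->
  'E_P[f \o X]%E = 'E_P[f \o Y]%E.
Proof.
move=> mX mY mf XY; rewrite unlock.
have law (g : T' -> \bar R) : measurable_fun [set: T'] g ->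
    (forall y, 0 <= g y)%E ->
    (\int[P]_x (g \o X) x = \int[P]_x (g \o Y) x)%E.
  move=> mg g0.
  rewrite -!(@ge0_integral_pushforward _ _ _ _ _ _ _ P setT)//=.
  by apply: eq_measure_integral => A mA _; exact: XY.
rewrite [LHS]integralE [RHS]integralE.
have posE (Z : T -> T') := funepos_comp (EFin \o f) Z.
have negE (Z : T -> T') := funeneg_comp (EFin \o f) Z.
rewrite [X in (\int[_]_w X w - _)%E](posE X).
rewrite [X in (_ - \int[_]_w X w)%E](negE X).
rewrite [X in _ = (\int[_]_w X w - _)%E](posE Y).
rewrite [X in _ = (_ - \int[_]_w X w)%E](negE Y).
congr (_ - _)%E; apply: law => //.
- exact/measurable_funepos/measurable_EFinP.
- exact/measurable_funeneg/measurable_EFinP.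
Qed.

Lemma variance_comp_identically_distributed (R : realType)
    (d d' : measure_display) (T : measurableType d) (T' : measurableType d')
    (P : probability T R) (X Y : T -> T') (f : T' -> R) :
  measurable_fun [set: T] X -> measurable_fun [set: T] Y ->
  measurable_fun [set: T'] f -> identically_distributed P X Y ->
  'V_P[f \o X]%E = 'V_P[f \o Y]%E.
Proof.
move=> mX mY mf XY; rewrite /variance !covariance.unlock.
rewrite (@expectation_comp_identically_distributed _ _ _ _ _ P X Y)//.
set c := fine _.
apply: (@expectation_comp_identically_distributed _ _ _ _ _ P X Y
  ((f \- cst c) * (f \- cst c))) => //.
by apply: measurable_funM; apply: measurable_funB.
Qed.

(** The product rule on rectangles says that the law of the pair is the
    product of the laws; Fubini's theorem then factors the mean of the product
    of the centered variables, and each of them has mean zero. *)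
Lemma covariance_independent (R : realType) (d : measure_display)
    (T : measurableType d) (P : probability T R) (X Y : {RV P >-> R}) :
  (forall A B, measurable A -> measurable B ->
    P (X @^-1` A `&` Y @^-1` B) = (P (X @^-1` A) * P (Y @^-1` B))%E) ->
  (X : T -> R) \in Lfun P 2%:E -> (Y : T -> R) \in Lfun P 2%:E ->
  covariance P X Y = 0%E.
Proof.
move=> indXY X2 Y2.
have Pfin : P setT \is a fin_num := fin_num_measure P _ measurableT.
have Y1 := Lfun_subset12 Pfin Y2.
rewrite unlock.
set a := fine _; set b := fine _.
have X'2 : (X \- cst a) \in Lfun P 2%:E.
  by rewrite rpredB ?lee1n//= Lfun_cst.
have Y'2 : (Y \- cst b) \in Lfun P 2%:E.
  by rewrite rpredB ?lee1n//= Lfun_cst.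
have /Lfun1_integrable iXY := Lfun2_mul_Lfun1 X'2 Y'2.
have Y'0 : (\int[distribution P Y]_y (y - b)%:E = 0)%E.
  rewrite integral_distribution//.
  - transitivity ('E_P[Y \- cst b])%E; first by rewrite unlock.
    rewrite expectationB// ?Lfun_cst// expectation_cst fineK ?subee//;
      exact: expectation_fin_num.
  - by apply/measurable_EFinP; apply: measurable_funB.
  - by apply/Lfun1_integrable; apply: Lfun_subset12 Y'2.
have mXY : measurable_fun [set: T] (fun w => (X w, Y w)).
  exact: measurable_fun_pair.
pose f (z : R * R) : \bar R := ((z.1 - a) * (z.2 - b))%:E.
have mf : measurable_fun [set: R * R] f.
  by apply/measurable_EFinP; apply: measurable_funM; apply: measurable_funB.
pose Z : {RV P >-> (R * R)%type} := mfun_Sub (mem_set mXY).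
have prodE A : measurable A ->
    (distribution P X \x distribution P Y)%E A = distribution P Z A.
  apply: product_measure_unique => A1 A2 mA1 mA2.
  exact: indXY.
rewrite unlock -[LHS]/(\int[P]_w (f \o Z) w)%E -integral_distribution//.
rewrite -(@eq_measure_integral _ _ _ _ _
  (distribution P X \x distribution P Y)%E); last first.
  by move=> A mA _; exact: prodE.
rewrite -integral12_prod_meas1; last first.
  apply/integrableP; split=> //.
  rewrite (@eq_measure_integral _ _ _ _ (distribution P Z)); last first.
    by move=> A mA _; exact: prodE.
  have := @integrable_pushforward _ _ _ _ _ _ mXY P setT f mf iXY measurableT.
  by move=> /integrableP[].
rewrite integral0_eq// => x _; rewrite /fubini_F /f /=.
under eq_integral do rewrite EFinM.
rewrite integralZl// ?Y'0 ?mule0//.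
apply: (@integrable_pushforward _ _ _ _ _ Y) => //.
- by apply/measurable_EFinP; apply: measurable_funB.
- by apply/Lfun1_integrable; apply: Lfun_subset12 Y'2.
Qed.

Lemma Lfun_sum (R : realType) (d : measure_display)
    (T : measurableType d) (P : probability T R) (p : R)
    (I : eqType) (r : seq I) (Z : I -> T -> R) : 1 <= p ->
  (forall i, i \in r -> Z i \in Lfun P p%:E) ->
  (fun x => \sum_(i <- r) Z i x) \in Lfun P p%:E.
Proof.
move=> p1 Z2.
have -> : (fun x => \sum_(i <- r) Z i x) = \sum_(i <- r) Z i.
  by apply/funext => x; rewrite fct_sumE.
by rewrite big_seq rpred_sum.
Qed.

Lemma expectation_sum_fun (R : realType) (d : measure_display)
    (T : measurableType d) (P : probability T R)
    (I : eqType) (r : seq I) (Z : I -> T -> R) :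
  (forall i, i \in r -> Z i \in Lfun P 1) ->
  ('E_P[fun x => (\sum_(i <- r) Z i x)%R] = \sum_(i <- r) 'E_P[Z i])%E.
Proof.
move=> Z1.
have -> : (fun x => \sum_(i <- r) Z i x) = \sum_(i <- r) Z i.
  by apply/funext => x; rewrite fct_sumE.
rewrite -(big_map Z predT id) expectation_sum ?big_map//.
by move=> _ /mapP[i ir ->]; exact: Z1.
Qed.

Lemma variance_sum_uncorrelated (R : realType) (d : measure_display)
    (T : measurableType d) (P : probability T R)
    (I : eqType) (r : seq I) (Z : I -> T -> R) : uniq r ->
  (forall i, i \in r -> Z i \in Lfun P 2%:E) ->
  (forall i j, i != j -> covariance P (Z i) (Z j) = 0%E) ->
  ('V_P[fun x => (\sum_(i <- r) Z i x)%R] = \sum_(i <- r) 'V_P[Z i])%E.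
Proof.
move=> + + Z0; elim: r => [_ _|i r IH /= /andP[ir ur] Z2].
  rewrite big_nil (_ : (fun _ => _) = cst 0) ?variance_cst//.
  by apply/funext => x; rewrite big_nil.
have Zi2 : Z i \in Lfun P 2%:E by rewrite Z2 ?mem_head.
have Zr2 j : j \in r -> Z j \in Lfun P 2%:E.
  by move=> jr; rewrite Z2// inE jr orbT.
have -> : (fun x => \sum_(j <- i :: r) Z j x) =
    Z i \+ (fun x => \sum_(j <- r) Z j x).
  by apply/funext => x; rewrite big_cons.
rewrite varianceD ?Lfun_sum ?ler1n// big_cons IH// -[RHS]adde0; congr (_ + _)%E.
suff -> : covariance P (Z i) (fun x => \sum_(j <- r) Z j x) = 0%E.
  by rewrite mule0.
elim: r ir {IH ur Z2} Zr2 => [_ _|j r IH].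
  rewrite (_ : (fun _ => _) = cst 0) ?covariance_cst_r//.
  by apply/funext => x; rewrite big_nil.
rewrite inE negb_or => /andP[ij ir] Zr2.
have Zr2' k : k \in r -> Z k \in Lfun P 2%:E.
  by move=> kr; rewrite Zr2// inE kr orbT.
have -> : (fun x => \sum_(k <- j :: r) Z k x) =
    Z j \+ (fun x => \sum_(k <- r) Z k x).
  by apply/funext => x; rewrite big_cons.
by rewrite covarianceDr ?Lfun_sum ?ler1n ?Zi2 ?Zr2 ?mem_head// Z0// IH// add0e.
Qed.

(** Functions of different members of the family satisfy the product rule: the
    preimages of two Borel sets are measurable sets in the possibly different
    types of the two members. *)
Lemma covariance_mutually_independent (R : realType) (dO : measure_display)
    (Omega : measurableType dO) (Pr : probability Omega R) (I : eqType)
    (d : measure_display) (T : I -> measurableType d)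
    (X : forall i, Omega -> T i) (f : forall i, T i -> R) :
  mutually_independent Pr X ->
  (forall i, measurable_fun [set: Omega] (X i)) ->
  (forall i, measurable_fun [set: T i] (f i)) ->
  (forall i, f i \o X i \in Lfun Pr 2%:E) ->
  forall i j, i != j -> covariance Pr (f i \o X i) (f j \o X j) = 0%E.
Proof.
move=> indX mX mf fX2 i j ij.
have mfX k : measurable_fun [set: Omega] (f k \o X k).
  exact: measurableT_comp.
pose Z k : {RV Pr >-> R} := mfun_Sub (mem_set (mfX k)).
apply: (@covariance_independent _ _ _ _ (Z i) (Z j));
  rewrite /Z //= => A B mA mB.
have uij : uniq [:: i; j] by rewrite /= inE ij.
pose C k : set (T k) := f k @^-1` (if k == i then A else B).
have mC k : measurable (C k).
  rewrite -[C k]setTI; apply: (mf k) => //.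
  by case: ifP.
have := indX _ uij C mC; rewrite !big_cons !big_nil setIT mule1.
by rewrite /C eqxx eq_sym (negbTE ij).
Qed.

(** Half of the tolerance is spent on the bias, the other half on the
    statistical error. *)
Lemma chebyshev_with_bias (R : realType) (d : measure_display)
    (T : measurableType d) (P : probability T R) (Y : T -> R)
    (a e v TOL eps : R) :
  measurable_fun [set: T] Y -> 'E_P[Y]%E = e%:E -> 'V_P[Y] = v%:E ->
  0 < TOL -> `|e - a| <= TOL / 2 -> v <= eps * (TOL / 2) ^+ 2 ->
  (P [set x | (TOL <= `|Y x - a|)%R] <= eps%:E)%E.
Proof.
move=> mY EY VY T0 ea ve.
have T20 : 0 < TOL / 2 by rewrite divr_gt0.
pose Y' : {RV P >-> R} := mfun_Sub (mem_set mY).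
have msub (b t : R) : measurable [set x | t <= `|Y x - b|].
  rewrite -[X in measurable X]setTI.
  apply: (@measurable_fun_le _ _ _ setT (cst t) (fun x => `|Y x - b|)) => //.
  by apply: measurableT_comp => //; exact: measurable_funB.
apply: (@le_trans _ _ (P [set x | (TOL / 2 <= `|Y x - e|)%R])).
  apply: le_measure; rewrite ?inE// => x /= Tx.
  have := ler_distD e (Y x) a; lra.
have := @chebyshev _ _ _ P Y' _ T20; rewrite /Y' /= EY VY /=.
move=> /le_trans; apply.
by rewrite -EFinM lee_fin ler_pdivrMl ?exprn_gt0// mulrC.
Qed.

(** * Moments of the multilevel estimator *)

Section Estimator.
Context (R : realType) (dO : measure_display) (Omega : measurableType dO).
Context (Pr : probability Omega R).
Context (d : measure_display) (In : measurableType d) (beta : nat).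
Variables (phi : forall N P : nat, P.-tuple In -> R).
Variables (coarse : forall N l : nat, (beta ^ l).-tuple In -> R).
Variables (omega : nat -> Omega -> In).
Variables (samples : forall l m : nat, Omega -> (beta ^ l).-tuple In).
Hypothesis omega_meas : forall p, measurable_fun [set: Omega] (omega p).
Hypothesis samples_meas :
  forall l m, measurable_fun [set: Omega] (samples l m).
Hypothesis samples_law : forall l m,
  identically_distributed Pr (samples l m) (inputs omega (beta ^ l)).
Hypothesis samples_indep : mutually_independent Pr
  (T := fun i : nat * nat => (beta ^ i.1).-tuple In)
  (fun i : nat * nat => samples i.1 i.2).
Variable N : nat.
Let D l := level_diff phi coarse N l.
Hypothesis D_meas :
  forall l, measurable_fun [set: (beta ^ l).-tuple In] (@D l).
Variable v : nat -> R.
Hypothesis D_variance :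
  forall l, 'V_Pr[@D l \o inputs omega (beta ^ l)] = (v l)%:E.

Lemma measurable_inputs P : measurable_fun [set: Omega] (inputs omega P).
Proof.
apply/measurable_fun_tnthP => i; rewrite (_ : _ \o _ = omega i)//.
by apply/funext => x /=; rewrite tnth_mktuple.
Qed.

Lemma variance_level_diff_samples l m :
  'V_Pr[@D l \o samples l m] = (v l)%:E.
Proof.
rewrite -D_variance.
apply: (@variance_comp_identically_distributed R _ _ Omega
  ((beta ^ l).-tuple In) Pr (samples l m) (inputs omega (beta ^ l)) (@D l)).
- exact: samples_meas.
- exact: measurable_inputs.
- exact: D_meas.
- exact: samples_law.
Qed.

Lemma expectation_level_diff_samples l m :
  'E_Pr[@D l \o samples l m]%E = 'E_Pr[@D l \o inputs omega (beta ^ l)]%E.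
Proof.
apply: (@expectation_comp_identically_distributed R _ _ Omega
  ((beta ^ l).-tuple In) Pr (samples l m) (inputs omega (beta ^ l)) (@D l)).
- exact: samples_meas.
- exact: measurable_inputs.
- exact: D_meas.
- exact: samples_law.
Qed.

Lemma Lfun2_level_diff_samples l m : @D l \o samples l m \in Lfun Pr 2%:E.
Proof.
apply: Lfun2_of_variance; last by rewrite variance_level_diff_samples ltry.
by apply: measurableT_comp; [exact: D_meas|exact: samples_meas].
Qed.

(** The double sum is flattened over the pairs (l, m), so that it falls under
    the lemmas on sums of uncorrelated families. *)
Let grid (L : nat) (M : nat -> nat) :=
  [seq (l, m) | l <- index_iota 0 L.+1, m <- index_iota 0 (M l)].

Let summand (M : nat -> nat) (i : nat * nat) : Omega -> R :=
  (M i.1)%:R^-1 \o* (@D i.1 \o samples i.1 i.2).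

Lemma mlmc_estimatorE L M : mlmc_estimator phi coarse samples L N M =
  fun x => \sum_(i <- grid L M) summand M i x.
Proof.
apply/funext => x; rewrite big_allpairs_dep; apply: eq_bigr => l _.
by rewrite mulr_sumr; apply: eq_bigr => m _; rewrite /summand /= mulrC.
Qed.

Lemma Lfun2_summand M i : summand M i \in Lfun Pr 2%:E.
Proof. by rewrite Lfun_scale ?ler1n// Lfun2_level_diff_samples. Qed.

Lemma Lfun2_mlmc_estimator L M :
  mlmc_estimator phi coarse samples L N M \in Lfun Pr 2%:E.
Proof.
by rewrite mlmc_estimatorE Lfun_sum ?ler1n// => i _; exact: Lfun2_summand.
Qed.

(** The estimator is one sum of pairwise uncorrelated variables, indexed by
    all the samples of all the levels. *)
Lemma variance_mlmc_estimator L M :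
  'V_Pr[mlmc_estimator phi coarse samples L N M] =
  (\sum_(0 <= l < L.+1) v l / (M l)%:R)%:E.
Proof.
rewrite mlmc_estimatorE variance_sum_uncorrelated//; last 3 first.
- apply: allpairs_uniq_dep => [|l _|[l m] [l' m'] _ _ /= [-> ->]//];
    exact: iota_uniq.
- by move=> i _; exact: Lfun2_summand.
- apply: (@covariance_mutually_independent _ _ _ _ _ _ _ _
    (fun i => (M i.1)%:R^-1 \o* @D i.1) samples_indep) => i.
  + exact: samples_meas.
  + by apply: measurable_funM => //; exact: D_meas.
  + exact: Lfun2_summand.
rewrite big_allpairs_dep -sumEFin; apply: eq_bigr => l _ /=.
transitivity (\sum_(0 <= m < M l) ((M l)%:R^-1 ^+ 2 * v l)%:E)%E.
  apply: eq_bigr => m _; rewrite varianceZ ?Lfun2_level_diff_samples//.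
  by rewrite variance_level_diff_samples.
rewrite sumEFin sumr_const_nat subn0 -mulr_natl; congr _%:E.
have [->|M0] := eqVneq (M l) 0%N; first by rewrite mulr0n mul0r invr0 mulr0.
by field; rewrite pnatr_eq0.
Qed.

Lemma expectation_mlmc_estimator (e : nat -> R) L M :
  (forall l, (l <= L)%N -> (0 < M l)%N) ->
  (forall l, 'E_Pr[@D l \o inputs omega (beta ^ l)]%E = (e l)%:E) ->
  'E_Pr[mlmc_estimator phi coarse samples L N M]%E =
  (\sum_(0 <= l < L.+1) e l)%:E.
Proof.
move=> M0 De.
have Pfin : Pr setT \is a fin_num := fin_num_measure Pr _ measurableT.
rewrite mlmc_estimatorE expectation_sum_fun; last first.
  by move=> i _; apply: Lfun_subset12 => //; exact: Lfun2_summand.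
rewrite big_allpairs_dep -sumEFin; apply: eq_big_nat => l /andP[_ lL] /=.
transitivity (\sum_(0 <= m < M l) ((M l)%:R^-1 * e l)%:E)%E.
  apply: eq_bigr => m _; rewrite expectationZl; last first.
    by apply: Lfun_subset12 => //; exact: Lfun2_level_diff_samples.
  by rewrite expectation_level_diff_samples De.
rewrite sumEFin sumr_const_nat subn0; congr _%:E.
by rewrite -[LHS]mulr_natl mulVKf// pnatr_eq0 -lt0n M0.
Qed.

End Estimator.

(** * Level sums and the complexity rate *)

Lemma exprn_powR (R : realType) (x a : R) (n : nat) : 0 <= x ->
  (x ^+ n) `^ a = (x `^ a) ^+ n.
Proof.
move=> x0; rewrite -(powR_mulrn n x0) -(powR_mulrn n (powR_ge0 x a)).
exact: powRAC.
Qed.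

Lemma natrX_powR (R : realType) (b l : nat) (a : R) :
  (b ^ l)%:R `^ a = (b%:R `^ a) ^+ l.
Proof. by rewrite natrX exprn_powR. Qed.

Lemma sumr_geom_gt1 (R : realFieldType) (q : R) (L : nat) : 1 < q ->
  \sum_(0 <= l < L.+1) q ^+ l <= q / (q - 1) * q ^+ L.
Proof.
move=> q1; have q10 : 0 < q - 1 by rewrite subr_gt0.
rewrite mulrAC ler_pdivlMr// big_mkord mulrC -subrX1 exprS.
by rewrite lerBlDr lerDl.
Qed.

Lemma sumr_geom_lt1 (R : realFieldType) (q : R) (L : nat) : 0 <= q -> q < 1 ->
  \sum_(0 <= l < L.+1) q ^+ l <= (1 - q)^-1.
Proof.
move=> q0 q1; have q10 : 0 < 1 - q by rewrite subr_gt0.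
rewrite -[leRHS]mul1r ler_pdivlMr// mulrC big_mkord -opprB mulNr -subrX1 opprB.
by rewrite gerBl exprn_ge0.
Qed.

Lemma mlmc_rate_gt0 (R : realType) (gamma s TOL : R) :
  0 < TOL -> TOL < expR (- 1) -> 0 < mlmc_rate gamma s TOL.
Proof.
move=> T0 T1; rewrite /mlmc_rate.
have T3 : 0 < TOL ^- 3 by rewrite invr_gt0 exprn_gt0.
case: ifP => // _; case: ifP => _; last exact: powR_gt0.
by rewrite mulr_gt0// exprn_gt0// ln_gt0// invf_gt1// (lt_trans T1)//
  expR_lt1 ltrN10.
Qed.

Lemma ln_inv_gt1 (R : realType) (TOL : R) :
  0 < TOL -> TOL < expR (- 1) -> 1 < ln TOL^-1.
Proof.
move=> T0 T1; rewrite lnV ?posrE// ltrNr -[ltRHS]expRK.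
by rewrite ltr_ln ?posrE ?expR_gt0.
Qed.

(** When s + 1 >= gamma one has 1 + gamma <= 2 + s <= 3, and otherwise
    1 + gamma <= 2 + gamma - s: both comparisons are s <= 1. *)
Lemma cost_one_sample_le_rate (R : realType) (gamma s TOL : R) :
  s <= 1 -> 0 < TOL -> TOL < expR (- 1) ->
  TOL^-1 `^ (1 + gamma) <= mlmc_rate gamma s TOL.
Proof.
move=> s1 T0 T1.
have l1 := ln_inv_gt1 T0 T1.
have h1 : 1 <= TOL^-1.
  by rewrite invf_ge1// ltW// (lt_trans T1)// expR_lt1 ltrN10.
have h0 : 0 <= TOL^-1 by exact: le_trans h1.
have h3 : gamma <= 2 -> TOL^-1 `^ (1 + gamma) <= TOL ^- 3.
  move=> g2; rewrite -exprVn -powR_mulrn//.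
  by rewrite ler_powR//; lra.
rewrite /mlmc_rate; case: ifP => [gs|]; first by apply: h3; lra.
case: ifP => [/eqP gs _|_ _].
  apply: le_trans (h3 _) _; first by lra.
  rewrite ler_peMr//; first by rewrite -exprVn exprn_ge0.
  by rewrite exprn_ege1// ltW.
rewrite (_ : -2 - gamma + s = -1 * (2 + gamma - s)); last by ring.
by rewrite [leRHS]powRrM powR_inv1 ?(ltW T0)// ler_powR//; lra.
Qed.

(** A geometric sum is bounded, or consists of L + 1 = O(ln TOL^-1) equal
    terms, or is dominated by its last term, whose square r ^ (2 L) equals
    (b ^ L) ^ (gamma - s - 1). *)
Lemma level_sum_le_rate (R : realType) (b gamma s K : R) :
    1 < b -> 1 <= K ->
  exists2 A : R, 0 <= A & forall (TOL : R) (L : nat),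
    0 < TOL -> TOL < expR (- 1) -> b ^+ L <= K / TOL ->
    TOL ^- 3 * (\sum_(0 <= l < L.+1) (b `^ ((gamma - s - 1) / 2)) ^+ l) ^+ 2
    <= A * mlmc_rate gamma s TOL.
Proof.
move=> b1 K1; have b0 : 0 < b by exact: lt_trans b1.
have K0 : 0 < K by exact: lt_le_trans K1.
set r := b `^ _.
have rE : r = expR ((gamma - s - 1) / 2 * ln b) by rewrite /r /powR gt_eqF.
have r0 : 0 <= r by exact: powR_ge0.
have sum0 L : 0 <= \sum_(0 <= l < L.+1) r ^+ l.
  by apply: sumr_ge0 => l _; exact: exprn_ge0.
have T3 (TOL : R) : 0 < TOL -> 0 <= TOL ^- 3.
  by move=> T0; rewrite invr_ge0 exprn_ge0// ltW.
have [gs|gs|gs] := ltgtP gamma (s + 1).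
- have r1 : r < 1.
    by rewrite rE expR_lt1 pmulr_llt0 ?ln_gt0//; lra.
  exists ((1 - r)^-1 ^+ 2) => [|TOL L T0 T1 _]; first exact: sqr_ge0.
  rewrite /mlmc_rate gs mulrC ler_wpM2r ?T3//.
  by rewrite ler_sqr ?nnegrE ?invr_ge0 ?subr_ge0 ?(ltW r1)// sumr_geom_lt1.
- have r1 : 1 < r by rewrite rE expR_gt1 mulr_gt0 ?ln_gt0//; lra.
  have gs' : 0 < gamma - s - 1 by lra.
  exists ((r / (r - 1)) ^+ 2 * K `^ (gamma - s - 1)) => [|TOL L T0 T1 bL].
    by rewrite mulr_ge0 ?sqr_ge0 ?powR_ge0.
  have h0 : 0 < TOL^-1 by rewrite invr_gt0.
  have rateE : TOL `^ (-2 - gamma + s) = TOL ^- 3 * TOL^-1 `^ (gamma - s - 1).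
    rewrite -exprVn -powR_mulrn ?(ltW h0)// -powRD; last first.
      by apply/implyP => _; rewrite gt_eqF.
    rewrite -(powR_inv1 (ltW T0)) -powRrM; congr (_ `^ _); ring.
  rewrite /mlmc_rate ltNge (ltW gs) /= lt_eqF// rateE.
  rewrite [leRHS]mulrCA ler_wpM2l ?T3//.
  rewrite -mulrA -powRM ?(ltW K0) ?(ltW h0)//.
  apply: (@le_trans _ _ ((r / (r - 1) * r ^+ L) ^+ 2)).
    rewrite ler_sqr ?nnegrE// ?sumr_geom_gt1// mulr_ge0 ?exprn_ge0//.
    by rewrite divr_ge0// subr_ge0 ltW.
  rewrite exprMn ler_wpM2l ?sqr_ge0//.
  have -> : (r ^+ L) ^+ 2 = (b ^+ L) `^ (gamma - s - 1).
    rewrite exprn_powR ?(ltW b0)// exprAC; congr (_ ^+ L).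
    rewrite -(powR_mulrn 2 r0) /r -powRrM; congr (_ `^ _).
    by field.
  by rewrite ge0_ler_powR ?nnegrE ?exprn_ge0 ?mulr_ge0 ?(ltW b0) ?(ltW K0)
    ?(ltW h0) ?(ltW gs').
- have r1 : r = 1.
    by rewrite rE (_ : _ / 2 = 0) ?mul0r ?expR0// gs; field.
  have lnb : 0 < ln b by rewrite ln_gt0.
  exists (((ln K + 1) / ln b + 1) ^+ 2) => [|TOL L T0 T1 bL].
    exact: sqr_ge0.
  have l1 := ln_inv_gt1 T0 T1.
  have lnK : 0 <= ln K by rewrite ln_ge0.
  rewrite /mlmc_rate gs ltxx eqxx [leRHS]mulrCA ler_wpM2l ?T3//.
  rewrite -exprMn; under eq_bigr do rewrite r1 expr1n.
  rewrite sumr_const_nat subn0 ler_sqr ?nnegrE ?ler0n//; last first.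
    rewrite mulr_ge0 ?addr_ge0 ?divr_ge0 ?addr_ge0// ltW//; lra.
  have : L%:R * ln b <= ln K + ln TOL^-1.
    rewrite mulr_natl -lnXn// -lnM ?posrE ?invr_gt0//.
    by rewrite ler_ln ?posrE ?exprn_gt0 ?divr_gt0.
  rewrite -ler_pdivlMr// => LL.
  rewrite -natr1 mulrDl mul1r lerD//; last exact: ltW.
  apply: le_trans LL _; rewrite mulrAC ler_pM2r ?invr_gt0//.
  by rewrite mulrDl mul1r lerD// ler_peMr// ltW.
Qed.

(** The left-hand side is, up to a constant, the work with b ^ L time steps:
    one sample per level for rounding, and the optimal allocation. *)
Lemma work_le_rate (R : realType) (b gamma s K C : R) :
    2 <= b -> 1 <= K -> 0 <= C -> 1 <= gamma -> s <= 1 ->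
  exists2 A : R, 0 <= A & forall (TOL : R) (L : nat),
    0 < TOL -> TOL < expR (- 1) -> b ^+ L <= K / TOL ->
    b ^+ L * (\sum_(0 <= l < L.+1) (b `^ gamma) ^+ l +
      C * TOL ^- 2 *
        (\sum_(0 <= l < L.+1) (b `^ ((gamma - s - 1) / 2)) ^+ l) ^+ 2)
    <= A * mlmc_rate gamma s TOL.
Proof.
move=> b2 K1 C0 g1 s1.
have b1 : 1 < b by apply: lt_le_trans b2; rewrite ltr1n.
have b0 : 0 < b by exact: lt_trans b1.
have K0 : 0 < K by exact: lt_le_trans K1.
have [A A0 HA] := level_sum_le_rate gamma s b1 K1.
have g2 : 2 <= b `^ gamma.
  by apply: le_trans b2 _; rewrite le1r_powR// ltW.
exists (2 * K `^ (1 + gamma) + C * K * A) => [|TOL L T0 T1 bL].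
  by rewrite addr_ge0 ?mulr_ge0 ?powR_ge0// ltW.
have h0 : 0 < TOL^-1 by rewrite invr_gt0.
rewrite mulrDr [leRHS]mulrDl lerD//.
  apply: (@le_trans _ _ (b ^+ L * (2 * (b `^ gamma) ^+ L))).
    rewrite ler_wpM2l ?exprn_ge0 ?(ltW b0)//.
    apply: le_trans (sumr_geom_gt1 _ _) _; first by lra.
    rewrite ler_wpM2r ?exprn_ge0 ?powR_ge0// ler_pdivrMr; lra.
  rewrite mulrCA -mulrA ler_pM2l//.
  have -> : b ^+ L * (b `^ gamma) ^+ L = (b ^+ L) `^ (1 + gamma).
    have bL0 : 0 < b ^+ L by exact: exprn_gt0.
    rewrite powRD; last by rewrite (gt_eqF bL0) implybT.
    by rewrite powRr1 ?(ltW bL0)// exprn_powR// ltW.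
  apply: (@le_trans _ _ ((K / TOL) `^ (1 + gamma))).
    rewrite ge0_ler_powR ?nnegrE ?exprn_ge0 ?mulr_ge0 ?(ltW b0) ?(ltW K0)//.
    - by rewrite addr_ge0// (le_trans ler01).
    - exact: ltW.
  rewrite powRM ?(ltW K0) ?(ltW h0)// ler_wpM2l ?powR_ge0//.
  exact: cost_one_sample_le_rate.
set S := \sum_(_ <= _ < _) _.
apply: (@le_trans _ _ (K / TOL * (C * TOL ^- 2 * S ^+ 2))).
  rewrite ler_wpM2r// mulr_ge0 ?sqr_ge0// mulr_ge0//.
  by rewrite invr_ge0 sqr_ge0.
have -> : K / TOL * (C * TOL ^- 2 * S ^+ 2) = C * K * (TOL ^- 3 * S ^+ 2).
  by field; rewrite gt_eqF.
by rewrite -[leRHS]mulrA ler_wpM2l ?HA// mulr_ge0// ltW.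
Qed.

(** The first power of beta above x overshoots by at most a factor beta. *)
Lemma finest_level_exists (R : realType) (beta : nat) (x : R) :
  (2 <= beta)%N -> 1 <= x ->
  exists L, x <= beta%:R ^+ L /\ beta%:R ^+ L <= beta%:R * x.
Proof.
move=> beta2 x1.
have b1 : 1 <= beta%:R :> R by rewrite ler1n (leq_trans _ beta2).
have ex : exists n, x <= beta%:R ^+ n.
  exists (Num.truncn x).+1; apply/ltW/(lt_le_trans (truncnS_gt x)).
  by rewrite -natrX ler_nat ltnW// ltn_expl.
case: (ex_minnP ex) => -[|L] xL minL.
  exists 0%N; split=> //; rewrite expr0.
  by rewrite -[leLHS]mulr1 ler_pM.
exists L.+1; split=> //; rewrite exprS ler_wpM2l//.
by rewrite leNgt; apply/negP => /ltW /minL; rewrite ltnn.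
Qed.

(** The optimal allocation: with S the sum of the r ^ l, the numbers M_l are the
    C S (r / g) ^ l rounded up, where C is the reciprocal of the variance
    to be reached. Rounding up costs at most one extra sample per level. *)
Lemma sample_numbers_exist (R : realType) (w g r C : R) (L : nat) :
  0 < g -> 0 < r -> w * g = r ^+ 2 -> 0 < C ->
  exists M : nat -> nat, [/\ (forall l, (0 < M l)%N),
    \sum_(0 <= l < L.+1) w ^+ l / (M l)%:R <= C^-1 &
    \sum_(0 <= l < L.+1) (M l)%:R * g ^+ l <=
      \sum_(0 <= l < L.+1) g ^+ l + C * (\sum_(0 <= l < L.+1) r ^+ l) ^+ 2].
Proof.
move=> g0 r0 wg C0; set S := \sum_(0 <= l < L.+1) r ^+ l.
have w0 : 0 < w by rewrite -(pmulr_lgt0 _ g0) wg exprn_gt0.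
have S0 : 0 < S.
  rewrite /S big_nat_recl// ltr_wpDr ?expr0//.
  by apply: sumr_ge0 => l _; rewrite exprn_ge0// ltW.
pose y l : R := C * S * (r / g) ^+ l.
have y0 l : 0 < y l by rewrite !mulr_gt0// exprn_gt0// divr_gt0.
exists (fun l => (Num.truncn (y l)).+1); split=> //.
- apply: (@le_trans _ _ (\sum_(0 <= l < L.+1) (C * S)^-1 * r ^+ l)).
    apply: ler_sum => l _.
    apply: (@le_trans _ _ (w ^+ l / y l)).
      rewrite ler_wpM2l ?exprn_ge0 ?(ltW w0)// lef_pV2 ?posrE//.
      exact/ltW/truncnS_gt.
    have -> : w = r * (r / g) by rewrite mulrA -expr2 -wg mulfK// gt_eqF.
    rewrite le_eqVlt; apply/orP; left; apply/eqP; rewrite /y exprMn.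
    have := y0 l; rewrite /y => yl.
    field; rewrite !gt_eqF// ?exprn_gt0// divr_gt0//.
  by rewrite -mulr_sumr -/S invfM mulfVK ?gt_eqF.
- apply: (@le_trans _ _ (\sum_(0 <= l < L.+1) (g ^+ l + C * S * r ^+ l))).
    apply: ler_sum => l _.
    have -> : g ^+ l + C * S * r ^+ l = (y l + 1) * g ^+ l.
      rewrite /y mulrDl mul1r addrC; congr (_ + _).
      by rewrite -[RHS]mulrA -exprMn divfK// gt_eqF.
    rewrite ler_wpM2r ?exprn_ge0 ?(ltW g0)// -natr1 lerD2r.
    by have /andP[] := truncn_itv (ltW (y0 l)).
  by rewrite big_split /= -mulr_sumr -/S expr2 mulrA.
Qed.

(** * The complexity theorem *)

(** Enlarging the constant of a bound makes it positive, so that the choice of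
    the parameters can divide by it. *)
Lemma lesssim_ge1 (R : realType) (I : Type) (D : I -> Prop) (a : I -> \bar R)
    (b : I -> R) : lesssim D a b -> (forall i, 0 <= b i) ->
  exists2 c : R, 1 <= c & forall i, D i -> (a i <= (c * b i)%:E)%E.
Proof.
move=> [c ac] b0; exists (Num.max 1 c) => [|i Di]; first by rewrite le_max lexx.
apply/ltW/(lt_le_trans (ac i Di)).
by rewrite lee_fin ler_wpM2r// le_max lexx orbT.
Qed.

(** The zero below level 0 is the value of the coarse coupling on level 0. *)
Lemma sumr_telescope (V : zmodType) (p : nat -> V) (L : nat) :
  \sum_(0 <= l < L.+1) (p l - if l is l'.+1 then p l' else 0) = p L.
Proof.
elim: L => [|L IH]; first by rewrite big_nat1 subr0.
by rewrite big_nat_recr//= IH addrC subrK.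
Qed.

Lemma measurable_particle_average (R : realType)
    (dI dS : measure_display) (In : measurableType dI) (S : measurableType dS)
    (X : forall N P : nat, P.-tuple In -> P.-tuple S) (psi : S -> R)
    (N P : nat) :
  measurable_fun [set: P.-tuple In] (X N P) -> measurable_fun [set: S] psi ->
  measurable_fun [set: P.-tuple In] (particle_average psi X N P).
Proof.
move=> mX mpsi; apply: measurable_funM => //.
apply: measurable_sum => p; apply: measurableT_comp => //.
by apply: (measurableT_comp (@measurable_tnth _ _ _ p)).
Qed.

Theorem mainTheorem4
  (R : realType)
  (dO : measure_display) (Omega : measurableType dO) (Pr : probability Omega R)
  (dI : measure_display) (In : measurableType dI)
  (dS : measure_display) (S : measurableType dS)
  (* i.i.d. inputs of the particles *)
  (omega : nat -> Omega -> In)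
  (omega_meas : forall p, measurable_fun [set: Omega] (omega p))
  (omega_iid : iid Pr omega)
  (* final particle states and quantity of interest *)
  (X : forall N P : nat, P.-tuple In -> P.-tuple S)
  (X_meas : forall N P, (0 < N)%N -> (0 < P)%N ->
    measurable_fun [set: P.-tuple In] (X N P))
  (X_exch : forall N P, (0 < N)%N -> (0 < P)%N ->
    exchangeable Pr (X N P \o inputs omega P))
  (psi : S -> R) (psi_meas : measurable_fun [set: S] psi)
  (phi_infty gamma s : R) (gamma_ge1 : 1 <= gamma)
  (s_ge0 : 0 <= s) (s_le1 : s <= 1)
  (beta : nat) (beta_ge2 : (2 <= beta)%N)
  (coarse : forall N l : nat, (beta ^ l).-tuple In -> R)
  (coarse_coupl : coarse_coupling (particle_average psi X) coarse Pr omega)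
  (* samples of omega_{1:P_l}, mutually independent over (l, m) *)
  (samples : forall l m : nat, Omega -> (beta ^ l).-tuple In)
  (samples_meas : forall l m, measurable_fun [set: Omega] (samples l m))
  (samples_law : forall l m,
    identically_distributed Pr (samples l m) (inputs omega (beta ^ l)))
  (samples_indep : mutually_independent Pr
    (T := fun i : nat * nat => (beta ^ i.1).-tuple In)
    (fun i : nat * nat => samples i.1 i.2))
  (work : nat -> nat -> R) (work_ge0 : forall N l, 0 <= work N l)
  (bias : lesssim (fun NP : nat * nat => (0 < NP.1)%N /\ (0 < NP.2)%N)
    (fun NP =>
      `|'E_Pr[particle_average psi X NP.1 NP.2 \o inputs omega NP.2]
        - phi_infty%:E|%E)
    (fun NP => NP.1%:R^-1 + NP.2%:R^-1))
  (variance : lesssim (fun NP : nat * nat => (0 < NP.1)%N /\ (0 < NP.2)%N)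
    (fun NP =>
      'V_Pr[particle_average psi X NP.1 NP.2 \o inputs omega NP.2])
    (fun NP => NP.2%:R^-1))
  (variance_diff : lesssim (fun Nl : nat * nat => (0 < Nl.1)%N)
    (fun Nl =>
      'V_Pr[level_diff (particle_average psi X) coarse Nl.1 Nl.2
            \o inputs omega (beta ^ Nl.2)])
    (fun Nl => (beta ^ Nl.2)%:R `^ (- s - 1)))
  (work_bound : lesssim (fun Nl : nat * nat => (0 < Nl.1)%N)
    (fun Nl => (work Nl.1 Nl.2)%:E)
    (fun Nl => Nl.1%:R * (beta ^ Nl.2)%:R `^ gamma))
  (eps : R) (eps_gt0 : 0 < eps) (eps_lt1 : eps < 1) :
  exists c : R, forall TOL : R, 0 < TOL -> TOL < expR (- 1) ->
  exists (L N : nat) (M : nat -> nat),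
    [/\ (0 < N)%N,
        (forall l, (l <= L)%N -> (0 < M l)%N),
        (Pr [set x | (TOL <=
            `|mlmc_estimator (particle_average psi X) coarse samples L N M x
              - phi_infty|)%R] <= eps%:E)%E &
        mlmc_work work L N M < c * mlmc_rate gamma s TOL].
Proof.
set phi := particle_average psi X in coarse_coupl bias variance variance_diff *.
have beta_gt0 l : (0 < beta ^ l)%N by rewrite expn_gt0 (leq_trans _ beta_ge2).
have inv_ge0 (n : nat) : 0 <= n%:R^-1 :> R by rewrite invr_ge0.
have [cb cb1 biasE] := lesssim_ge1 bias
  (fun NP => addr_ge0 (inv_ge0 _) (inv_ge0 _)).
have [cw cw1 workE] := lesssim_ge1 work_bound
  (fun Nl => mulr_ge0 (ler0n _ _) (powR_ge0 _ _)).
have [cd cd1 diffE] := lesssim_ge1 variance_diff (fun Nl => powR_ge0 _ _).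
have [cv _ varE] := lesssim_ge1 variance (fun NP => inv_ge0 _).
have Pfin : Pr setT \is a fin_num := fin_num_measure Pr _ measurableT.
have inputs_meas P : measurable_fun [set: Omega] (inputs omega P).
  exact: measurable_inputs.
have phi_meas N l : (0 < N)%N ->
    measurable_fun [set: (beta ^ l).-tuple In] (phi N (beta ^ l)%N).
  by move=> N0; apply: measurable_particle_average => //; exact: X_meas.
have D_meas N l : (0 < N)%N ->
    measurable_fun [set: (beta ^ l).-tuple In] (level_diff phi coarse N l).
  move=> N0; apply: measurable_funB; first exact: phi_meas.
  exact: coarse_measurable coarse_coupl _ _ N0.
have phi1 N l : (0 < N)%N ->
    phi N (beta ^ l)%N \o inputs omega (beta ^ l) \in Lfun Pr 1.
  move=> N0; apply: Lfun_subset12 => //; apply: Lfun2_of_variance.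
    by apply: measurableT_comp; [exact: phi_meas|exact: inputs_meas].
  apply: le_lt_trans (ltry _).
  exact: (varE (N, beta ^ l)%N (conj N0 (beta_gt0 l))).
have D2 N l : (0 < N)%N ->
    level_diff phi coarse N l \o inputs omega (beta ^ l) \in Lfun Pr 2%:E.
  move=> N0; apply: Lfun2_of_variance.
    by apply: measurableT_comp; [exact: D_meas|exact: inputs_meas].
  apply: le_lt_trans (ltry _).
  exact: (diffE (N, l) N0).
pose p N l := fine 'E_Pr[phi N (beta ^ l)%N \o inputs omega (beta ^ l)]%E.
have D_mean N l : (0 < N)%N ->
    'E_Pr[level_diff phi coarse N l \o inputs omega (beta ^ l)]%E =
    (p N l - if l is l'.+1 then p N l' else 0)%:E.
  move=> N0.
  pose ph := phi N (beta ^ l)%N \o inputs omega (beta ^ l).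
  pose co := coarse N l \o inputs omega (beta ^ l).
  have ph1 : ph \in Lfun Pr 1 by exact: phi1.
  have D1 : ph \- co \in Lfun Pr 1 by apply: Lfun_subset12 => //; exact: D2.
  (* The coarse coupling is integrable as a difference of phi and D. *)
  have co1 : co \in Lfun Pr 1.
    have -> : co = ph \- (ph \- co) by apply/funext => x /=; rewrite subKr.
    by rewrite rpredB.
  rewrite -[LHS]/('E_Pr[ph \- co]%E) expectationB// EFinB.
  rewrite /p fineK; last exact: expectation_fin_num.
  congr (_ - _)%E; case: l @ph @co {ph1 D1} co1 => [|l] ph co co1.
    rewrite (_ : co = cst 0) ?expectation_cst//.
    by apply/funext => x; exact: coarse_level0 coarse_coupl _ _ N0.
  rewrite (coarse_mean coarse_coupl l N0) fineK//.
  by apply: expectation_fin_num; exact: phi1.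
pose v N l := fine 'V_Pr[level_diff phi coarse N l \o inputs omega (beta ^ l)].
have D_var N l : (0 < N)%N ->
    'V_Pr[level_diff phi coarse N l \o inputs omega (beta ^ l)] = (v N l)%:E.
  by move=> N0; rewrite /v fineK// variance_fin_num// D2.
pose b : R := beta%:R.
have b2 : 2 <= b by rewrite /b ler_nat.
have b0 : 0 < b by exact: lt_le_trans b2.
(* With b ^ L >= K / TOL, the bias 2 cb / b ^ L is at most TOL / 2. *)
pose K := 4 * cb.
have K1 : 1 <= K by rewrite /K; lra.
(* The variance cd * TOL ^ 2 / C then equals eps * (TOL / 2) ^ 2. *)
pose C := 4 * cd / eps.
have C0 : 0 < C by rewrite /C divr_gt0//; lra.
pose w := b `^ (- s - 1); pose g := b `^ gamma.
pose r := b `^ ((gamma - s - 1) / 2).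
have g0 : 0 < g by exact: powR_gt0.
have r0 : 0 < r by exact: powR_gt0.
have wg : w * g = r ^+ 2.
  rewrite /w /g /r -powRD; last by rewrite (gt_eqF b0) implybT.
  rewrite -[RHS]powR_mulrn ?powR_ge0// -powRrM; congr (_ `^ _).
  by field.
have b1 : 1 <= b by apply: le_trans b2; rewrite ler1n.
have bK1 : 1 <= b * K.
  by apply: (le_trans K1); apply: ler_peMl => //; exact: le_trans K1.
have [A A0 HA] := work_le_rate b2 bK1 (ltW C0) gamma_ge1 s_le1.
exists (cw * A + 1) => TOL T0 T1.
have rate0 := mlmc_rate_gt0 gamma s T0 T1.
have T1' : TOL <= 1 by rewrite ltW// (lt_trans T1)// expR_lt1 ltrN10.
have KT1 : 1 <= K / TOL by rewrite ler_pdivlMr// mul1r; lra.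
have [L [KL LK]] := finest_level_exists beta_ge2 KT1.
have CT0 : 0 < C * TOL ^- 2 by rewrite mulr_gt0// invr_gt0 exprn_gt0.
have [M [M0 MV MW]] := sample_numbers_exist L g0 r0 wg CT0.
pose N := (beta ^ L)%N.
have N0 : (0 < N)%N by exact: beta_gt0.
have NE : N%:R = b ^+ L by rewrite /N natrX.
exists L, N, M; split=> //.
- have est2 := Lfun2_mlmc_estimator omega_meas samples_meas samples_law
    (fun l => D_meas N l N0) (fun l => D_var N l N0) L M.
  apply: (chebyshev_with_bias (e := p N L)
    (v := \sum_(0 <= l < L.+1) v N l / (M l)%:R)) => //.
  + by have := sub_Lfun_mfun est2; rewrite inE.
  + rewrite (expectation_mlmc_estimator omega_meas samples_meas samples_law
      (fun l => D_meas N l N0) (fun l => D_var N l N0) (fun l _ => M0 l)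
      (fun l => D_mean N l N0)).
    by rewrite sumr_telescope.
  + exact: (variance_mlmc_estimator omega_meas samples_meas samples_law
      samples_indep (fun l => D_meas N l N0) (fun l => D_var N l N0)).
  + have pE : 'E_Pr[phi N N \o inputs omega N]%E = (p N L)%:E.
      by rewrite /p fineK//; apply: expectation_fin_num; exact: phi1.
    have /= := biasE (N, N) (conj N0 N0); rewrite pE.
    rewrite -EFinB abse_EFin lee_fin => /le_trans; apply.
    rewrite NE; have : (b ^+ L)^-1 <= TOL / K.
      rewrite -[leRHS]invf_div lef_pV2// posrE ?exprn_gt0//.
      by rewrite (lt_le_trans _ KT1).
    rewrite /K => bTK.
    apply: (@le_trans _ _ (cb * (TOL / (4 * cb) + TOL / (4 * cb)))).
      by rewrite ler_wpM2l ?lerD//; lra.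
    rewrite le_eqVlt; apply/orP; left; apply/eqP; field.
    by rewrite gt_eqF//; lra.
  + apply: (@le_trans _ _ (cd * \sum_(0 <= l < L.+1) w ^+ l / (M l)%:R)).
      rewrite mulr_sumr; apply: ler_sum => l _.
      rewrite mulrA ler_wpM2r ?inv_ge0// -lee_fin -D_var//.
      by apply: (le_trans (diffE (N, l) N0)); rewrite /= natrX_powR.
    apply: (@le_trans _ _ (cd * (C * TOL ^- 2)^-1)).
      by rewrite ler_wpM2l//; lra.
    rewrite le_eqVlt; apply/orP; left; apply/eqP; rewrite /C; field.
    by rewrite !gt_eqF//; lra.
- have -> : (cw * A + 1) * mlmc_rate gamma s TOL =
      cw * (A * mlmc_rate gamma s TOL) + mlmc_rate gamma s TOL by ring.
  apply: le_lt_trans (ltr_pwDr rate0 (lexx _)).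
  have bL : b ^+ L <= b * K / TOL by rewrite -mulrA.
  apply: le_trans (ler_wpM2l _ (HA TOL L T0 T1 bL)); last by lra.
  apply: (@le_trans _ _ (cw * (b ^+ L *
      \sum_(0 <= l < L.+1) (M l)%:R * g ^+ l))); last first.
    by rewrite ler_wpM2l ?ler_wpM2l// ?exprn_ge0 ?(ltW b0)//; lra.
  rewrite /mlmc_work mulrA mulr_sumr; apply: ler_sum => l _.
  rewrite [leRHS]mulrCA ler_wpM2l// -lee_fin.
  by apply: (le_trans (workE (N, l) N0)); rewrite /= natrX_powR NE mulrA.
Qed.
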